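(* Let $\mathcal{C}$ be a non-splitting CSS code on $n$ qubits of distance greater than $2$. Suppose there is some $k$ such that no $1$-local circuit in $\mathcal{C}_n^k\setminus\mathcal{C}_n^{k-1}$ is a logical identity of $\mathcal{C}$. Then for all $m\geq k$, no $1$-local circuit in $\mathcal{C}_n^m\setminus\mathcal{C}_n^{k-1}$ is a logical identity of $\mathcal{C}$.
   Context: The Clifford hierarchy: $\mathcal{C}_n^1=\mathcal{P}_n$ is the $n$-qubit Pauli group and, for $k>1$, $\mathcal{C}_n^k=\{U\in\mathcal{U}(2^n): U\mathcal{P}_nU^\dagger\subseteq\mathcal{C}_n^{k-1}\}$. A $1$-local circuit is a tensor product $C_1\otimes\cdots\otimes C_n$ of single-qubit gates. A CSS code $\mathsf{CSS}(A,B)$ on $n$ qubits is given by subspaces $A,B\subseteq\mathbb{F}_2^n$ with $a\cdot b=0$ for all $a\in A,b\in B$; its codespace is the common $+1$-eigenspace of $X^a$ ($a\in A$) and $Z^b$ ($b\in B$), where $G^a=\bigotimes_{i:a_i=1}G_i$. A logical identity is an operator acting as the identity on the codespace. A subspace $A$ splits on a non-empty $h\subsetneq\{1,\dots,n\}$ if $A=A_1\oplus A_2$ with $A_1$ having support $h$ and $A_2$ supported on the complement of $h$; the code splits on $h$ if both $A$ and $B$ do, and is non-splitting if it splits on no such $h$. *)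

(* Defs.v *)
From HB Require Import structures.
From mathcomp Require Import all_boot all_order all_algebra all_field reals.
From mathcomp.real_closed Require Import complex.
Set Implicit Arguments. Unset Strict Implicit. Unset Printing Implicit Defensive.
Import GRing.Theory Num.Theory.
Local Open Scope ring_scope.

Section Quantum.
Variable R : realType.
Local Notation C := R[i].

(* n-qubit operators: 2^n x 2^n complex matrices; basis index x : 'I_(2^n)
   is read as the bitstring whose i-th bit is odd (x / 2^i). *)
Definition qbit (n : nat) (x : 'I_(2 ^ n)) (i : 'I_n) : 'I_2 :=
  inord (odd (x %/ 2 ^ i)).

Definition tensor (n : nat) (G : 'I_n -> 'M[C]_2) : 'M[C]_(2 ^ n) :=
  \matrix_(x, y) \prod_(i < n) G i (qbit x i) (qbit y i).

Definition adjoint (m : nat) (U : 'M[C]_m) : 'M[C]_m := (map_mx Num.conj U)^T.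

Definition unitary (m : nat) (U : 'M[C]_m) : Prop :=
  U *m adjoint U = 1%:M /\ adjoint U *m U = 1%:M.

Definition pauliX : 'M[C]_2 := \matrix_(i, j) (if i == j then 0 else 1).
Definition pauliZ : 'M[C]_2 :=
  \matrix_(i, j) (if i == j then (if i == 0 :> 'I_2 then 1 else -1) else 0).

Definition pauli_group (n : nat) (U : 'M[C]_(2 ^ n)) : Prop :=
  exists (c : 'I_4) (a b : 'I_n -> bool),
    U = ('i ^+ c) *: tensor (fun i => (if a i then pauliX else 1%:M)
                                     *m (if b i then pauliZ else 1%:M)).

(* Clifford hierarchy: clifford n k = C_n^k (k >= 1); C_n^0 is taken empty. *)
Fixpoint clifford (n k : nat) (U : 'M[C]_(2 ^ n)) {struct k} : Prop :=
  match k with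
  | 0 => False
  | k'.+1 =>
    match k' with
    | 0 => pauli_group U
    | _ => unitary U /\
           forall P, pauli_group P -> clifford k' (U *m P *m adjoint U)
    end
  end.

Definition one_local (n : nat) (U : 'M[C]_(2 ^ n)) : Prop :=
  exists G : 'I_n -> 'M[C]_2, (forall i, unitary (G i)) /\ U = tensor G.

Definition pow_op (n : nat) (G : 'M[C]_2) (a : 'rV['F_2]_n) : 'M[C]_(2 ^ n) :=
  tensor (fun i => if a 0 i != 0 then G else 1%:M).

Definition codespace (n : nat) (A B : {vspace 'rV['F_2]_n}) (psi : 'cV[C]_(2 ^ n))
  : Prop :=
  (forall a, a \in A -> pow_op pauliX a *m psi = psi) /\
  (forall b, b \in B -> pow_op pauliZ b *m psi = psi).

Definition logical_identity (n : nat) (A B : {vspace 'rV['F_2]_n})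
  (U : 'M[C]_(2 ^ n)) : Prop :=
  forall psi, codespace A B psi -> U *m psi = psi.

End Quantum.

Definition dotF2 (n : nat) (a b : 'rV['F_2]_n) : 'F_2 := \sum_(i < n) a 0 i * b 0 i.

Definition css_code (n : nat) (A B : {vspace 'rV['F_2]_n}) : Prop :=
  forall a b, a \in A -> b \in B -> dotF2 a b = 0.

Definition weight (n : nat) (a : 'rV['F_2]_n) : nat := #|[set i | a 0 i != 0]|.

(* distance of CSS(A,B) > d: every nontrivial logical X-type operator
   (a in B^perp \ A) and every nontrivial logical Z-type operator
   (b in A^perp \ B) has weight > d. *)
Definition css_distance_gt (n : nat) (A B : {vspace 'rV['F_2]_n}) (d : nat) : Prop :=
  (forall a, (forall b, b \in B -> dotF2 a b = 0) -> a \notin A -> (d < weight a)%N) /\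
  (forall b, (forall a, a \in A -> dotF2 a b = 0) -> b \notin B -> (d < weight b)%N).

Definition supported_on (n : nat) (V : {vspace 'rV['F_2]_n}) (h : {set 'I_n}) : Prop :=
  forall v, v \in V -> forall i, i \notin h -> v 0 i = 0.

Definition vsplits (n : nat) (A : {vspace 'rV['F_2]_n}) (h : {set 'I_n}) : Prop :=
  exists A1 A2 : {vspace 'rV['F_2]_n},
    [/\ supported_on A1 h, supported_on A2 (~: h), (A1 :&: A2 = 0)%VS
      & A = (A1 + A2)%VS].

Definition code_splits (n : nat) (A B : {vspace 'rV['F_2]_n}) (h : {set 'I_n}) : Prop :=
  vsplits A h /\ vsplits B h.

Definition non_splitting (n : nat) (A B : {vspace 'rV['F_2]_n}) : Prop :=
  forall h : {set 'I_n}, h != set0 -> h != setT -> ~ code_splits A B h.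

(* Main.v *)
(** For [U] 1-local and [S] a stabilizer, [U S U^dag] is again a 1-local logical
    identity, one level lower in the hierarchy. Distance and non-splitting make the
    supports of [A] and of [B] cover all qubits (if n > 1), so that stabilizers
    restrict to every Pauli at every qubit; since tensor products lie in a level
    [>= 2] iff each factor does, some [U S U^dag] sits exactly one level below [U].
    Hence exact levels of logical identities can be lowered one by one to [k].
    For n = 1 the code is spanned by an eigenvector of X or Z, and [U^2] takes the
    role of [U S U^dag]. *)
Require Import Defs.
From mathcomp Require Import all_boot all_order all_algebra all_field reals.
From mathcomp.real_closed Require Import complex.
From mathcomp Require Import ring.
From Stdlib Require Import Classical.
Set Implicit Arguments. Unset Strict Implicit. Unset Printing Implicit Defensive.
Import GRing.Theory Num.Theory.
Local Open Scope ring_scope.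

(** * Basis indices as bitstrings *)

Lemma eq_from_bits n x y : (x < 2 ^ n)%N -> (y < 2 ^ n)%N ->
  (forall i, (i < n)%N -> odd (x %/ 2 ^ i) = odd (y %/ 2 ^ i)) -> x = y.
Proof.
elim: n x y => [|n IHn] x y; first by rewrite expn0 !ltnS !leqn0 => /eqP-> /eqP->.
rewrite expnS => ltx lty bits.
rewrite -(odd_double_half x) -(odd_double_half y).
have := bits 0%N isT; rewrite !divn1 => ->; congr (_ + _.*2)%N.
apply: IHn => [||i ltin]; rewrite -?divn2 ?ltn_divLR 1?mulnC //.
by rewrite -!divnMA -expnS; apply: bits.
Qed.

Section Qubits.
Variable R : realType.
Local Notation C := R[i].

Definition bits n (x : 'I_(2 ^ n)) : {ffun 'I_n -> 'I_2} := [ffun i => qbit x i].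

Lemma bits_inj n : injective (@bits n).
Proof.
move=> x y /ffunP eqxy; apply/val_inj/(@eq_from_bits n) => [||i ltin].
- exact: (ltn_ord x).
- exact: (ltn_ord y).
have := eqxy (Ordinal ltin); rewrite !ffunE /qbit /= => /(congr1 val) /=.
by rewrite !inordK ?ltnS ?leq_b1 //; do 2![case: odd].
Qed.

Lemma bits_bij n : bijective (@bits n).
Proof.
by apply: inj_card_bij (@bits_inj n) _; rewrite card_ffun !card_ord.
Qed.

Lemma qbit_surj n (f : 'I_n -> 'I_2) : exists x : 'I_(2 ^ n), forall i, qbit x i = f i.
Proof.
have [g _ gK] := bits_bij n; exists (g (finfun f)) => i.
by have /ffunP/(_ i) := gK (finfun f); rewrite !ffunE.
Qed.

(** * Tensor products, adjoints and unitaries *)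

Lemma tensor_mul n (G H : 'I_n -> 'M[C]_2) :
  tensor G *m tensor H = tensor (fun i => G i *m H i).
Proof.
apply/matrixP => x z; rewrite !mxE.
under [RHS]eq_bigr do rewrite mxE.
(* A product over qubits of sums over one bit expands into a sum over all bit functions, which
   [bits] identifies with basis indices. *)
rewrite (bigA_distr_bigA (fun i j => G i (qbit x i) j * H i j (qbit z i))).
have bij : {on predT, bijective (@bits n)} by apply: onW_bij; apply: bits_bij.
rewrite (reindex _ bij) /=; apply: eq_bigr => y _.
by rewrite !mxE -big_split /=; apply: eq_bigr => i _; rewrite ffunE.
Qed.

Lemma eq_tensor n (G H : 'I_n -> 'M[C]_2) : G =1 H -> tensor G = tensor H.
Proof.
by move=> eqGH; apply/matrixP => x y; rewrite !mxE; apply: eq_bigr => i _; rewrite eqGH.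
Qed.

Lemma tensor1 n : tensor (fun _ : 'I_n => 1%:M) = 1%:M :> 'M[C]__.
Proof.
apply/matrixP => x y; rewrite !mxE.
case: eqVneq => [<-|neq_xy]; first by rewrite big1 // => i _; rewrite mxE eqxx.
have [i neqi] : exists i, qbit x i != qbit y i.
  apply/existsP; apply: contraNT neq_xy; rewrite negb_exists => /forallP eqxy.
  by apply/eqP/bits_inj/ffunP => i; rewrite !ffunE; apply/eqP; rewrite -[_ == _]negbK.
by rewrite (bigD1 i) //= mxE (negPf neqi) mul0r.
Qed.

Lemma tensor_scale n (c : 'I_n -> C) (G : 'I_n -> 'M[C]_2) :
  tensor (fun i => c i *: G i) = (\prod_i c i) *: tensor G.
Proof.
by apply/matrixP => x y; rewrite !mxE -big_split; apply: eq_bigr => i _; rewrite mxE.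
Qed.

Lemma adjoint_mul m (U V : 'M[C]_m) : adjoint (U *m V) = adjoint V *m adjoint U.
Proof. by rewrite /adjoint map_mxM trmx_mul. Qed.

Lemma adjoint_scale m c (U : 'M[C]_m) : adjoint (c *: U) = c^* *: adjoint U.
Proof. by apply/matrixP => x y; rewrite !mxE rmorphM. Qed.

Lemma adjointK m : involutive (@adjoint R m).
Proof. by move=> U; apply/matrixP => x y; rewrite !mxE conjCK. Qed.

Lemma adjoint1 m : adjoint 1%:M = 1%:M :> 'M[C]_m.
Proof. by rewrite /adjoint map_mx1 trmx1. Qed.

Lemma adjoint_tensor n (G : 'I_n -> 'M[C]_2) :
  adjoint (tensor G) = tensor (fun i => adjoint (G i)).
Proof.
by apply/matrixP => x y; rewrite !mxE rmorph_prod; apply: eq_bigr => i _; rewrite !mxE.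
Qed.

Lemma unitary1 m : unitary (1%:M : 'M[C]_m).
Proof. by rewrite /unitary adjoint1 mulmx1. Qed.

Lemma unitary_mul m (U V : 'M[C]_m) : unitary U -> unitary V -> unitary (U *m V).
Proof.
move=> [UU' U'U] [VV' V'V]; rewrite /unitary adjoint_mul; split.
  by rewrite mulmxA -(mulmxA U) VV' mulmx1.
by rewrite mulmxA -(mulmxA _ _ U) U'U mulmx1.
Qed.

Lemma unitary_adjoint m (U : 'M[C]_m) : unitary U -> unitary (adjoint U).
Proof. by case=> UU' U'U; rewrite /unitary adjointK. Qed.

Lemma unitary_scale m c (U : 'M[C]_m) : c * c^* = 1 -> unitary U -> unitary (c *: U).
Proof.
move=> c1 [UU' U'U]; rewrite /unitary adjoint_scale -!scalemxAl -!scalemxAr !scalerA.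
by rewrite (mulrC _ c) c1 !scale1r.
Qed.

Lemma unitary_tensor n (G : 'I_n -> 'M[C]_2) :
  (forall i, unitary (G i)) -> unitary (tensor G).
Proof.
move=> GU; rewrite /unitary adjoint_tensor !tensor_mul -tensor1.
by split; apply: eq_tensor => i; case: (GU i).
Qed.

Lemma unitary_neq0 m (U : 'M[C]_m.+1) : unitary U -> exists s t, U s t != 0.
Proof.
case=> UU' _; suff /existsP[s /existsP[t ?]] : [exists s, [exists t, U s t != 0]].
  by exists s, t.
apply: contra_eqT UU' => /existsPn U0.
have -> : U = 0.
  apply/matrixP => s t; rewrite mxE; apply/eqP; rewrite -[_ == _]negbK.
  by have /existsPn := U0 s; apply.
by rewrite mul0mx eq_sym oner_neq0.
Qed.

(** Fixing every qubit but [i] at a nonzero entry of [H j] turns equality of tensor entries into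
    proportionality of [G i] and [H i]. *)
Lemma tensor_eq_scale n (G H : 'I_n -> 'M[C]_2) (c : C) :
    c != 0 -> (forall i, unitary (H i)) -> tensor G = c *: tensor H ->
  forall i, exists d, G i = d *: H i.
Proof.
move=> c0 HU eqGH i.
have /fin_all_exists[p Hp] j : exists p : 'I_2 * 'I_2, H j p.1 p.2 != 0.
  by have [s [t]] := unitary_neq0 (HU j); exists (s, t).
pose g := \prod_(j | j != i) G j (p j).1 (p j).2.
pose h := \prod_(j | j != i) H j (p j).1 (p j).2.
have eq_st s t : G i s t * g = c * (H i s t * h).
  have [x xE] := qbit_surj (fun j => if j == i then s else (p j).1).
  have [y yE] := qbit_surj (fun j => if j == i then t else (p j).2).
  have /matrixP/(_ x y) := eqGH; rewrite !mxE.
  rewrite (bigD1 i) //= [\prod_i H _ _ _](bigD1 i) //= !xE !yE eqxx.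
  by congr (_ * _ = _ * (_ * _)); apply: eq_bigr => j /negPf ji; rewrite xE yE ji.
have h0 : h != 0 by apply/prodf_neq0 => j _.
have g0 : g != 0.
  have : c * (H i (p i).1 (p i).2 * h) != 0 by rewrite !mulf_neq0.
  by rewrite -eq_st mulf_eq0 negb_or => /andP[].
exists (c * h / g); apply/matrixP => s t; rewrite !mxE.
apply: (mulIf g0); rewrite eq_st mulrAC divfK //; ring.
Qed.

(** * Single-qubit Paulis *)

(** The four Paulis up to phase: [pauli true true] is XZ = -iY, which squares to -1. *)
Definition pauli (a b : bool) : 'M[C]_2 :=
  if a then if b then pauliX R *m pauliZ R else pauliX R
  else if b then pauliZ R else 1%:M.

Lemma pauliE a b :
  pauli a b = (if a then pauliX R else 1%:M) *m (if b then pauliZ R else 1%:M).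
Proof. by case: a; case: b; rewrite ?mulmx1 ?mul1mx. Qed.

Lemma pauliXX : pauliX R *m pauliX R = 1%:M.
Proof.
apply/matrixP => -[[|[|//]] ?] [[|[|//]] ?].
all: rewrite !mxE !big_ord_recl big_ord0 !mxE /= -?val_eqE /=; ring.
Qed.

Lemma pauliZZ : pauliZ R *m pauliZ R = 1%:M.
Proof.
apply/matrixP => -[[|[|//]] ?] [[|[|//]] ?].
all: rewrite !mxE !big_ord_recl big_ord0 !mxE /= -?val_eqE /=; ring.
Qed.

Lemma pauliZX : pauliZ R *m pauliX R = - (pauliX R *m pauliZ R).
Proof.
apply/matrixP => -[[|[|//]] ?] [[|[|//]] ?].
all: rewrite !mxE !big_ord_recl !big_ord0 !mxE /= -?val_eqE /=; ring.
Qed.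

Lemma adjoint_pauliX : adjoint (pauliX R) = pauliX R.
Proof. by apply/matrixP => i j; rewrite !mxE eq_sym; case: eqP; rewrite ?rmorph0 ?rmorph1. Qed.
Lemma adjoint_pauliZ : adjoint (pauliZ R) = pauliZ R.
Proof.
apply/matrixP => i j; rewrite !mxE eq_sym; case: eqP => [->|_]; last by rewrite rmorph0.
by case: eqP; rewrite ?rmorphN1 ?rmorph1.
Qed.

Lemma unitary_pauli a b : unitary (pauli a b).
Proof.
rewrite pauliE; apply: unitary_mul; [case: a|case: b]; try exact: unitary1.
  by rewrite /unitary adjoint_pauliX pauliXX.
by rewrite /unitary adjoint_pauliZ pauliZZ.
Qed.

Lemma pauli_mul a b a' b' :
  pauli a b *m pauli a' b' = (-1) ^+ (b && a') *: pauli (a (+) a') (b (+) b').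
Proof.
have swap : (if b then pauliZ R else 1%:M) *m (if a' then pauliX R else 1%:M) =
    (-1) ^+ (b && a') *: ((if a' then pauliX R else 1%:M) *m (if b then pauliZ R else 1%:M)).
  case: b; case: a'; rewrite ?mulmx1 ?mul1mx ?expr0 ?scale1r //.
  by rewrite expr1 scaleN1r pauliZX.
rewrite !pauliE mulmxA -(mulmxA (if a then _ else _)) swap -scalemxAr -scalemxAl.
congr (_ *: _); rewrite -!mulmxA [RHS]/= mulmxA.
congr (_ *m _).
  by case: a; case: a' swap => _; rewrite ?mulmx1 ?mul1mx ?pauliXX.
by case: b swap; case: b'; rewrite ?mulmx1 ?mul1mx ?pauliZZ.
Qed.

Lemma pauli_ff : pauli false false = 1%:M.
Proof. by []. Qed.

Lemma pauli_mulC a b a' b' :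
  exists s : bool, pauli a b *m pauli a' b' = (-1) ^+ s *: (pauli a' b' *m pauli a b).
Proof.
exists ((b && a') (+) (b' && a)); rewrite !pauli_mul scalerA signr_addb -mulrA.
by rewrite -expr2 sqrr_sign mulr1 addbC (addbC b').
Qed.

Lemma pauli_conj a b a' b' :
  exists s : bool, pauli a b *m pauli a' b' *m adjoint (pauli a b) = (-1) ^+ s *: pauli a' b'.
Proof.
have [s ->] := pauli_mulC a b a' b'; exists s.
by have [PP' _] := unitary_pauli a b; rewrite -scalemxAl -mulmxA PP' mulmx1.
Qed.

Lemma pauli_sqr a b : pauli a b *m pauli a b = (-1) ^+ (b && a) *: 1%:M.
Proof. by rewrite pauli_mul !addbb pauli_ff. Qed.

Lemma expi_mod4 m : ('i ^+ (m %% 4) : C) = 'i ^+ m.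
Proof.
have i4 : ('i : C) ^+ 4 = 1 by rewrite (exprM _ 2 2) sqrCi sqrrN expr1n.
by rewrite [in RHS](divn_eq m 4) exprD mulnC exprM i4 expr1n mul1r.
Qed.

Lemma pauli_group_tensor n (d : nat) (a b : 'I_n -> bool) :
  pauli_group ('i ^+ d *: tensor (fun i => pauli (a i) (b i)) : 'M[C]_(2 ^ n)).
Proof.
exists (Ordinal (ltn_pmod d (isT : (0 < 4)%N))), a, b.
by rewrite /= expi_mod4; congr (_ *: _); apply: eq_tensor => i; rewrite pauliE.
Qed.

Lemma stabilizer_tensor n (a b : 'rV['F_2]_n) :
  pow_op (pauliX R) a *m pow_op (pauliZ R) b =
  tensor (fun i => pauli (a 0 i != 0) (b 0 i != 0)).
Proof. by rewrite tensor_mul; apply: eq_tensor => i; rewrite pauliE. Qed.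

(** * The hierarchy, factor by factor *)

(* The single-qubit hierarchy up to scalars, with levels shifted down by one. *)
Fixpoint hier (j : nat) (V : 'M[C]_2) : Prop :=
  if j is j'.+1 then forall a b, hier j' (V *m pauli a b *m adjoint V)
  else exists c a b, V = c *: pauli a b.

Lemma sign_unit (s : bool) : ((-1) ^+ s : C) * ((-1) ^+ s)^* = 1.
Proof. by case: s; rewrite ?expr0 ?expr1 ?rmorphN ?rmorph1 ?mulrNN mulr1. Qed.

Lemma conj_scale m c (U P : 'M[C]_m) : c * c^* = 1 ->
  (c *: U) *m P *m adjoint (c *: U) = U *m P *m adjoint U.
Proof.
by move=> c1; rewrite adjoint_scale -!scalemxAl -scalemxAr scalerA c1 scale1r.
Qed.

Lemma hier_scale j c V : c * c^* = 1 -> hier j V -> hier j (c *: V).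
Proof.
case: j => [|j] c1 /= HV; last by move=> a b; rewrite conj_scale.
by have [d [a [b ->]]] := HV; exists (c * d), a, b; rewrite scalerA.
Qed.

(** Paulis commute up to sign, so a Pauli factor on the right changes each conjugate by at most a
    sign. *)
Lemma hier_mul_pauli j a b V : hier j V -> hier j (V *m pauli a b).
Proof.
case: j => [|j] /= HV.
  have [c [a' [b' ->]]] := HV.
  by rewrite -scalemxAl pauli_mul scalerA; do 3!eexists.
move=> a' b'; rewrite adjoint_mul !mulmxA -(mulmxA V) -(mulmxA V).
have [s ->] := pauli_conj a b a' b'.
by rewrite -scalemxAr -scalemxAl; apply/hier_scale/HV/sign_unit.
Qed.

Lemma hier_pauli j a b : hier j (pauli a b).
Proof.
elim: j a b => [|j IHj] a b /=; first by exists 1, a, b; rewrite scale1r.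
by move=> a' b'; have [s ->] := pauli_conj a b a' b'; apply/hier_scale/IHj/sign_unit.
Qed.

(** A phase cancels in conjugation. The levels start at 2 because level 1 only admits powers of i as
    phases. *)
Lemma clifford_scale n j c (U : 'M[C]_(2 ^ n)) : c * c^* = 1 ->
  clifford j.+2 U -> clifford j.+2 (c *: U).
Proof.
move=> c1 [UU HU]; split; first exact: unitary_scale.
by move=> P /HU; rewrite conj_scale.
Qed.

Lemma expi_unit m : ('i ^+ m : C) * ('i ^+ m)^* = 1.
Proof. by rewrite rmorphXn /= conjCi -exprMn mulrN -expr2 sqrCi opprK expr1n. Qed.

Lemma expr4_eq1 (c : C) : c ^+ 4 = 1 -> exists d : nat, c = 'i ^+ d.
Proof.
move/eqP; rewrite (exprM _ 2 2) sqrf_eq1 => /orP[|/eqP c2].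
  rewrite sqrf_eq1 => /orP[]/eqP->; first by exists 0%N.
  by exists 2%N; rewrite sqrCi.
have /eqP : c ^+ 2 = 'i ^+ 2 by rewrite sqrCi.
rewrite eqf_sqr => /orP[]/eqP->; first by exists 1%N.
by exists 3%N; rewrite exprSr sqrCi mulN1r.
Qed.

(** Both the conjugate and [pauli a' b'] square to 1 or -1, hence c^4 = 1. This recovers the phases
    that [hier] forgets. *)
Lemma pauli_phase (V : 'M[C]_2) a b c a' b' : unitary V ->
  V *m pauli a b *m adjoint V = c *: pauli a' b' -> exists d, c = 'i ^+ d.
Proof.
move=> [VV' V'V] eqc; apply: expr4_eq1.
have : (V *m pauli a b *m adjoint V) *m (V *m pauli a b *m adjoint V) =
    (-1) ^+ (b && a) *: 1%:M.
  rewrite -!(mulmxA V) -mulmxA (mulmxA _ V) V'V mul1mx.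
  by rewrite (mulmxA (pauli a b)) pauli_sqr -scalemxAl mul1mx -scalemxAr VV'.
rewrite eqc -scalemxAl -scalemxAr pauli_sqr !scalerA => /matrixP/(_ 0 0).
rewrite !mxE eqxx !mulr1 -expr2 => eqc2.
have : (c ^+ 2 * (-1) ^+ (b' && a')) ^+ 2 = 1 by rewrite eqc2 sqrr_sign.
by rewrite exprMn sqrr_sign mulr1 -exprM.
Qed.

Lemma conj_tensor n (G H : 'I_n -> 'M[C]_2) :
  tensor G *m tensor H *m adjoint (tensor G) =
  tensor (fun i => G i *m H i *m adjoint (G i)).
Proof. by rewrite adjoint_tensor !tensor_mul. Qed.

Lemma clifford_hier n j (G : 'I_n -> 'M[C]_2) : (forall i, unitary (G i)) ->
  clifford j.+1 (tensor G) -> forall i, hier j (G i).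
Proof.
elim: j G => [|j IHj] G GU.
  case=> c [a [b eqG]] i.
  have c0 : ('i : C) ^+ c != 0 by rewrite expf_neq0 ?neq0Ci.
  have PU k : unitary (pauli (a k) (b k)) by exact: unitary_pauli.
  rewrite (eq_tensor (fun k => esym (pauliE (a k) (b k)))) in eqG.
  by have [d ->] := tensor_eq_scale c0 PU eqG i; exists d, (a i), (b i).
case=> _ HG i a b.
(* One Pauli repeated on all qubits tests every factor at once. *)
have := pauli_group_tensor 0 (fun _ : 'I_n => a) (fun _ => b).
rewrite expr0 scale1r => /HG; rewrite conj_tensor => /IHj; apply=> k.
by apply: unitary_mul (unitary_adjoint _); rewrite //; apply: unitary_mul (unitary_pauli _ _).
Qed.

(** The levels start at 2: at level 1 the scalars of the factors need not multiply to a power of i.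
    At level 2, [pauli_phase] gives a power of i at each qubit. *)
Lemma hier_clifford n j (G : 'I_n -> 'M[C]_2) : (forall i, unitary (G i)) ->
  (forall i, hier j.+1 (G i)) -> clifford j.+2 (tensor G).
Proof.
elim: j G => [|j IHj] G GU HG; split; try exact: unitary_tensor.
  move=> _ [c [a [b ->]]]; rewrite (eq_tensor (fun k => esym (pauliE (a k) (b k)))).
  rewrite -scalemxAr -scalemxAl conj_tensor /=.
  have /fin_all_exists[d /fin_all_exists[a' /fin_all_exists[b' Hd]]] i :
      exists d, exists a', exists b',
        G i *m pauli (a i) (b i) *m adjoint (G i) = 'i ^+ d *: pauli a' b'.
    have [e [a' [b' eqe]]] := HG i (a i) (b i).
    by have [d de] := pauli_phase (GU i) eqe; exists d, a', b'; rewrite -de.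
  rewrite (eq_tensor Hd) tensor_scale prodrXr scalerA -exprD.
  exact: pauli_group_tensor.
move=> _ [c [a [b ->]]]; rewrite (eq_tensor (fun k => esym (pauliE (a k) (b k)))).
rewrite -scalemxAr -scalemxAl conj_tensor.
apply/clifford_scale/IHj => [|i|i]; [exact: expi_unit| |exact: HG].
by apply: unitary_mul (unitary_adjoint _); rewrite //; apply: unitary_mul (unitary_pauli _ _).
Qed.

(** * Descent through stabilizers *)

(** If a unitary fixes every code state, so does its adjoint; hence each factor of the conjugate
    fixes them. *)
Lemma logical_identity_conj n (A B : {vspace 'rV['F_2]_n}) (U : 'M[C]_(2 ^ n)) a b :
    unitary U -> a \in A -> b \in B -> logical_identity A B U ->
  logical_identity A B (U *m (pow_op (pauliX R) a *m pow_op (pauliZ R) b) *m adjoint U).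
Proof.
move=> [_ U'U] aA bB UL psi psiL; have [XA ZB] := psiL.
rewrite -{1}(UL _ psiL) -!mulmxA (mulmxA (adjoint U)) U'U mul1mx.
by rewrite ZB // XA // UL.
Qed.

(* The conjugate of [tensor G] by a stabilizer is again a 1-local logical
   identity, one level lower; if all of these drop a further level, then each
   factor does, because all four Paulis occur at every qubit. *)
Lemma descent_covered n (A B : {vspace 'rV['F_2]_n}) j :
    (forall i, exists2 a, a \in A & a 0 i != 0) ->
    (forall i, exists2 b, b \in B & b 0 i != 0) ->
    (forall U : 'M[C]_(2 ^ n), one_local U -> clifford j.+2 U ->
       ~ clifford j.+1 U -> ~ logical_identity A B U) ->
  forall U : 'M[C]_(2 ^ n), one_local U -> clifford j.+3 U ->
    ~ clifford j.+2 U -> ~ logical_identity A B U.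
Proof.
move=> covA covB IH _ [G [GU ->]] [TU UC] UnC UL; apply: UnC.
apply: hier_clifford => // i al be.
have [a aA aE] : exists2 a, a \in A & (a 0 i != 0) = al.
  case: al; first by have [a] := covA i; exists a.
  by exists 0; rewrite ?mem0v // mxE eqxx.
have [b bB bE] : exists2 b, b \in B & (b 0 i != 0) = be.
  case: be; first by have [b] := covB i; exists b.
  by exists 0; rewrite ?mem0v // mxE eqxx.
have := logical_identity_conj TU aA bB UL.
have := UC (pow_op (pauliX R) a *m pow_op (pauliZ R) b).
have := pauli_group_tensor 0 (fun i => a 0 i != 0) (fun i => b 0 i != 0).
rewrite expr0 scale1r stabilizer_tensor conj_tensor => SP /(_ SP).
have GSU k : unitary (G k *m pauli (a 0 k != 0) (b 0 k != 0) *m adjoint (G k)).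
  by apply: unitary_mul (unitary_adjoint _); rewrite //; apply: unitary_mul (unitary_pauli _ _).
(* The conjugate is a logical identity in level [j.+2]; [IH] forbids it to lie outside level
   [j.+1]. *)
move=> SC SL; have SC' : clifford j.+1 (tensor (fun k =>
    G k *m pauli (a 0 k != 0) (b 0 k != 0) *m adjoint (G k))).
  by apply: NNPP => SnC; apply: IH SnC SL => //; eexists; split; first exact: GSU.
by have := clifford_hier GSU SC' i; rewrite aE bE.
Qed.

(** * The one-qubit case *)

Lemma tensor_ord1 (i : 'I_1) (G : 'I_1 -> 'M[C]_2) x y :
  tensor G x y = G i (qbit x i) (qbit y i).
Proof. by rewrite mxE big_ord1 (ord1 i). Qed.

Lemma tensor_ord1_inj (G H : 'I_1 -> 'M[C]_2) : tensor G = tensor H -> G =1 H.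
Proof.
move=> /matrixP eqGH i; apply/matrixP => s t.
have [x xE] := qbit_surj (fun _ : 'I_1 => s).
have [y yE] := qbit_surj (fun _ : 'I_1 => t).
by have := eqGH x y; rewrite !(tensor_ord1 i) xE yE.
Qed.

Lemma mulmx2E (M N : 'M[C]_2) s t : (M *m N) s t = M s 0 * N 0 t + M s 1 * N 1 t.
Proof.
rewrite mxE !big_ord_recl big_ord0 addr0.
by have -> : lift ord0 ord0 = 1 :> 'I_2 by apply: val_inj.
Qed.

Lemma mx2P (M N : 'M[C]_2) :
  M 0 0 = N 0 0 -> M 0 1 = N 0 1 -> M 1 0 = N 1 0 -> M 1 1 = N 1 1 -> M = N.
Proof.
move=> e00 e01 e10 e11; apply/matrixP => s t.
have ord2 (k : 'I_2) : k = 0 \/ k = 1.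
  by case: k => -[|[|//]] ltk; [left|right]; apply: val_inj.
by case: (ord2 s) => ->; case: (ord2 t) => ->.
Qed.

(* [V] fixes the +1 eigenvector of [P] and multiplies the other one by some [u],
   while [Q] exchanges the two eigenspaces, so that [V Q V Q] is the scalar [u]. *)
Lemma fix_eigenspace (V : 'M[C]_2) (z : bool) :
    let P := pauli (~~ z) z in let Q := pauli z (~~ z) in
    unitary V -> V *m (1%:M + P) = 1%:M + P ->
  V *m P = P *m V /\ exists u, V *m Q *m V *m Q = u *: 1%:M.
Proof.
move=> P Q [VV' V'V] fixP.
have PP : adjoint P = P.
  by rewrite /P; case: z {P Q fixP}; rewrite /= ?adjoint_pauliX ?adjoint_pauliZ.
(* The adjoint of [V] fixes 1 + P as well, and 1 + P is self-adjoint. *)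
have fixP' : (1%:M + P) *m V = 1%:M + P.
  have VS : adjoint V *m (1%:M + P) = 1%:M + P by rewrite -{1}fixP mulmxA V'V mul1mx.
  have SS : adjoint (1%:M + P) = 1%:M + P.
    by rewrite -[in RHS]PP -[in RHS]adjoint1 /adjoint map_mxD linearD.
  by rewrite -{1}SS -[V]adjointK -adjoint_mul VS.
have VP : V *m P = P *m V.
  apply: (addrI V); rewrite -{1}[V]mulmx1 -mulmxDr fixP.
  by rewrite -{1}[V]mul1mx -mulmxDl.
(* The eigenvalue of [V] on the -1 eigenvector of [P]; for P = Z the entry [V 1 0] vanishes. *)
split=> //; exists (V 1 1 - V 1 0).
have two0 : (2 : C) != 0 by rewrite pnatr_eq0.
have two0' : (-2 : C) != 0 by rewrite oppr_eq0.
have one0 := oner_neq0 C.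
(* Solves a linear equation: a nonzero multiple of the wanted equation is matched with a known one
   by [ring]. *)
have lin (c x y l r : C) : c != 0 -> l = r -> c * (x - y) = l - r -> x = y.
  move=> c0 ->; rewrite subrr => /eqP; rewrite mulf_eq0 (negPf c0) subr_eq0.
  by move/eqP.
move: fixP VP => /matrixP fixP /matrixP VP.
have := (VP 0 0, VP 0 1, VP 1 0, fixP 0 0); rewrite !(mulmx2E, mxE).
rewrite /P /Q {VV' V'V}; case: z {P Q PP fixP fixP' VP}; rewrite /= !mxE /=.
  move=> [[[_ e01] e10] f00].
  have V01 : V 0 1 = 0 by apply: (lin _ _ _ _ _ two0' e01); ring.
  have V10 : V 1 0 = 0 by apply: (lin _ _ _ _ _ two0 e10); ring.
  have V00 : V 0 0 = 1 by apply: (lin _ _ _ _ _ two0 f00); ring.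
  by apply: mx2P; rewrite !(mulmx2E, mxE) /= ?V01 ?V10 ?V00; ring.
move=> [[[e00 e01] _] f00].
have V01 : V 0 1 = V 1 0 by apply: (lin _ _ _ _ _ one0 e00); ring.
have V00 : V 0 0 = V 1 1 by apply: (lin _ _ _ _ _ one0 e01); ring.
have V10 : V 1 0 = 1 - V 1 1.
  by apply: (lin _ _ _ _ _ one0 f00); rewrite V00 V01; ring.
by apply: mx2P; rewrite !(mulmx2E, mxE) /= ?V01 ?V00 ?V10; ring.
Qed.

(** When one of [A], [B] vanishes, all stabilizers are powers of the single Pauli P (Z if [z], else
    X). Since 1 + P is twice the projector onto the +1 eigenspace of P, its image consists of code
    states. *)
Lemma logical_identity_ord1 (A B : {vspace 'rV['F_2]_1}) (z : bool) (U : 'M[C]_(2 ^ 1)) :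
    (if z then forall a, a \in A -> a 0 0 = 0 else forall b, b \in B -> b 0 0 = 0) ->
    logical_identity A B U ->
  U *m tensor (fun _ => 1%:M + pauli (~~ z) z) = tensor (fun _ => 1%:M + pauli (~~ z) z).
Proof.
move=> AB0 UL; set T := tensor _.
have fixT (psi : 'cV_(2 ^ 1)) : codespace A B (T *m psi) -> U *m T *m psi = T *m psi.
  by move=> TL; rewrite -mulmxA UL.
suff TL psi : codespace A B (T *m psi).
  apply/matrixP => x y; have := fixT _ (TL (delta_mx y 0)).
  by rewrite -!colE => /matrixP/(_ x 0); rewrite !mxE.
have absorb (P : 'M[C]_2) (c : 'rV['F_2]_1) : P *m P = 1%:M ->
    pow_op P c *m tensor (fun _ => 1%:M + P) = tensor (fun _ => 1%:M + P).
  move=> PP; rewrite tensor_mul; apply: eq_tensor => i.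
  by case: eqP => _; rewrite ?mul1mx //= mulmxDr mulmx1 PP addrC.
have pow_id (P : 'M[C]_2) (c : 'rV['F_2]_1) : c 0 0 = 0 -> pow_op P c = 1%:M.
  by move=> c0; rewrite -tensor1; apply: eq_tensor => i; rewrite (ord1 i) c0 eqxx.
split=> c cAB; rewrite mulmxA /T; case: z AB0 {T fixT} => AB0 /=.
- by rewrite pow_id ?AB0 // mul1mx.
- by rewrite absorb ?pauliXX.
- by rewrite absorb ?pauliZZ.
- by rewrite pow_id ?AB0 // mul1mx.
Qed.

(** The Pauli Q anticommuting with P is no stabilizer, so its conjugate is reached through U^2,
    which equals that conjugate times Q up to phase. *)
Lemma descent_ord1 (A B : {vspace 'rV['F_2]_1}) (z : bool) j :
    (if z then forall a, a \in A -> a 0 0 = 0 else forall b, b \in B -> b 0 0 = 0) ->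
    (forall U : 'M[C]_(2 ^ 1), one_local U -> clifford j.+2 U ->
       ~ clifford j.+1 U -> ~ logical_identity A B U) ->
  forall U : 'M[C]_(2 ^ 1), one_local U -> clifford j.+3 U ->
    ~ clifford j.+2 U -> ~ logical_identity A B U.
Proof.
move=> AB0 IH _ [G [GU ->]] UC UnC UL; apply: UnC.
have := clifford_hier GU UC 0; have := GU 0.
have := logical_identity_ord1 AB0 UL; rewrite tensor_mul => /tensor_ord1_inj/(_ 0).
set V := G 0; set P := pauli _ _ => fixV VU HV.
have [VP [u]] := fix_eigenspace VU fixV.
set Q := pauli _ _ => VQVQ; have [VV' V'V] := VU.
have QQ : Q *m Q = 1%:M by rewrite pauli_sqr andNb expr0 scale1r.
have u1 : u * u^* = 1.
  have [+ _] : unitary (V *m Q *m V *m Q).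
    by do 3![apply: unitary_mul (unitary_pauli _ _) || apply: unitary_mul VU || exact: VU].
  rewrite VQVQ adjoint_scale adjoint1 -scalemxAl mul1mx scalerA => /matrixP/(_ 0 0).
  by rewrite !mxE mulr1.
(* Multiply V Q V Q = u on the left by the conjugate of Q by V. *)
have VVQ : u *: (V *m Q *m adjoint V) = V *m V *m Q.
  have -> : V *m V *m Q = V *m Q *m (adjoint V *m (V *m Q *m V *m Q)).
    by rewrite !mulmxA -(mulmxA _ (adjoint V)) V'V mulmx1 -(mulmxA V Q) QQ mulmx1.
  by rewrite VQVQ -!scalemxAr mulmx1.
have VV : V *m V = u *: (V *m Q *m adjoint V) *m Q.
  by rewrite VVQ -mulmxA QQ mulmx1.
have UUU i : unitary (G i *m G i) by exact: unitary_mul.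
have UUL : logical_identity A B (tensor G *m tensor G).
  by move=> psi psiL; rewrite -mulmxA !UL.
rewrite tensor_mul in UUL.
have UUC : clifford j.+2 (tensor (fun i => G i *m G i)).
  apply: hier_clifford => // i; rewrite (ord1 i) -/V VV.
  by apply/hier_mul_pauli/hier_scale => //; apply: HV.
(* [IH] lowers U^2 once more; cancelling Q and the phase [u] lowers the conjugate of Q. *)
have HW : hier j (V *m Q *m adjoint V).
  have UUC' : clifford j.+1 (tensor (fun i => G i *m G i)).
    by apply: NNPP => UUnC; apply: IH UUC UUnC UUL; eexists; split; first exact: UUU.
  have := clifford_hier UUU UUC' 0; move/(hier_mul_pauli z (~~ z)); rewrite -/V -/Q -VVQ.
  move/(@hier_scale _ u^*); rewrite conjCK mulrC u1 scalerA mulrC u1 scale1r.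
  exact.
apply: hier_clifford => // i; rewrite (ord1 i) -/V => a b.
have VPV' : V *m P *m adjoint V = P by rewrite VP -mulmxA VV' mulmx1.
have cases : [\/ (a, b) = (false, false), (a, b) = (~~ z, z), (a, b) = (z, ~~ z)
               | (a, b) = (true, true)].
  case: (z) a b => -[] [];
    [exact: Or44|exact: Or43|exact: Or42|exact: Or41
    |exact: Or44|exact: Or42|exact: Or43|exact: Or41].
case: cases => -[-> ->].
- by rewrite mulmx1 VV'; apply: (hier_pauli _ false false).
- by rewrite VPV'; apply: hier_pauli.
- exact: HW.
(* For [z] false, Q P is ZX = -XZ, whence the sign. *)
have -> : pauli true true = (-1) ^+ (~~ z && ~~ z) *: (Q *m P).
  rewrite /Q /P pauli_mul scalerA -expr2 sqrr_sign scale1r.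
  by case: (z).
rewrite -scalemxAr -scalemxAl; apply: hier_scale (sign_unit _) _.
have -> : V *m (Q *m P) *m adjoint V = V *m Q *m adjoint V *m P.
  by rewrite -[in RHS]VPV' !mulmxA -(mulmxA _ (adjoint V)) V'V mulmx1.
exact: hier_mul_pauli.
Qed.
End Qubits.

(** * Splitting off a single qubit *)

Lemma dotF2C n (a b : 'rV['F_2]_n) : dotF2 a b = dotF2 b a.
Proof. by apply: eq_bigr => i _; rewrite mulrC. Qed.

Lemma dotF2_delta n (a : 'rV['F_2]_n) i : dotF2 a (delta_mx 0 i) = a 0 i.
Proof.
rewrite /dotF2 (bigD1 i) //= mxE !eqxx mulr1 big1 ?addr0 // => k /negPf ki.
by rewrite mxE ki andbF mulr0.
Qed.

Lemma weight_delta n (i : 'I_n) : weight (delta_mx 0 i) = 1%N.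
Proof.
apply/eqP/cards1P; exists i; apply/setP => k; rewrite !inE mxE eqxx.
by case: (k == i).
Qed.

(** The complement of the line is the part of [V] killed by coordinate [i]: subtracting [v 0 i *: e]
    from [v] stays in [V]. *)
Lemma vsplits_delta n (V : {vspace 'rV['F_2]_n}) i :
  delta_mx 0 i \in V -> vsplits V [set i].
Proof.
move=> eV; pose coord_i : 'Hom('rV['F_2]_n, 'cV['F_2]_1) := linfun (col i).
have kerP (v : 'rV_n) : (v \in lker coord_i) = (v 0 i == 0).
  rewrite memv_ker lfunE /=; apply/eqP/eqP => [/matrixP/(_ 0 0)|v0].
    by rewrite !mxE.
  by apply/matrixP => s t; rewrite !mxE !ord1.
pose e : 'rV['F_2]_n := delta_mx 0 i.
exists <[e]>%VS, (V :&: lker coord_i)%VS; split.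
- move=> _ /vlineP[c ->] k; rewrite inE !mxE => /negPf->.
  by rewrite andbF mulr0.
- move=> v /memv_capP[_]; rewrite kerP => /eqP v0 k.
  by rewrite !inE negbK => /eqP->.
- apply/eqP; rewrite -subv0; apply/subvP => _ /memv_capP[/vlineP[c ->]].
  move=> /memv_capP[_]; rewrite kerP !mxE !eqxx mulr1 => /eqP->.
  by rewrite scale0r mem0v.
apply/eqP; rewrite eqEsubv subv_add capvSl andbT -memvE eV andbT.
apply/subvP => v vV; rewrite -(subrKC (v 0 i *: e) v).
apply: memv_add; first by rewrite memvZ ?memv_line.
apply/memv_capP; split; first by rewrite memvB ?memvZ.
by rewrite kerP !mxE !eqxx mulr1 subrr.
Qed.

Lemma vsplits_uncovered n (V : {vspace 'rV['F_2]_n}) i :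
  (forall v, v \in V -> v 0 i = 0) -> vsplits V [set i].
Proof.
move=> V0; exists 0%VS, V; split; rewrite ?cap0v ?add0v //.
  by move=> v; rewrite memv0 => /eqP-> k _; rewrite mxE.
by move=> v vV k; rewrite !inE negbK => /eqP->; apply: V0.
Qed.

(** If [A] misses qubit [i], the unit vector at [i] is orthogonal to [A]; having weight 1, it must
    lie in [B] by the distance bound. Then both spaces split on [[set i]], which forces n = 1. The
    same holds with [A] and [B] exchanged. *)
Lemma descent (R : realType) n (A B : {vspace 'rV['F_2]_n}) j :
    non_splitting A B -> css_distance_gt A B 2 ->
    (forall U : 'M[R[i]]_(2 ^ n), one_local U -> clifford j.+2 U ->
       ~ clifford j.+1 U -> ~ logical_identity A B U) ->
  forall U : 'M[R[i]]_(2 ^ n), one_local U -> clifford j.+3 U ->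
    ~ clifford j.+2 U -> ~ logical_identity A B U.
Proof.
move=> nsAB [distX distZ] IH.
have uncovered (V : {vspace 'rV['F_2]_n}) :
    ~ (forall i, exists2 v, v \in V & v 0 i != 0) ->
    exists i, forall v, v \in V -> v 0 i = 0.
  move=> /not_all_ex_not[i noV]; exists i => v vV; apply/eqP; apply: contra_notT noV.
  by exists v.
have n1 i : vsplits A [set i] -> vsplits B [set i] -> n = 1%N.
  move=> splA splB; apply: NNPP => nn1; apply: (nsAB [set i]) => //.
    by apply/set0Pn; exists i; rewrite inE.
  by apply/eqP => /(congr1 (fun h : {set _} => #|h|)); rewrite cards1 cardsT card_ord => /esym.
case: (classic (forall i, exists2 a, a \in A & a 0 i != 0)) => [covA|/uncovered[i A0]].
  case: (classic (forall i, exists2 b, b \in B & b 0 i != 0)) => [covB|/uncovered[i B0]].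
    exact: descent_covered.
  have eA : delta_mx 0 i \in A.
    apply: contraT => /distX; rewrite weight_delta; apply=> b bB.
    by rewrite dotF2C dotF2_delta B0.
  have En := n1 i (vsplits_delta eA) (vsplits_uncovered B0); subst n.
  by apply: (@descent_ord1 R A B false) => //= b /B0; rewrite (ord1 i).
have eB : delta_mx 0 i \in B.
  by apply: contraT => /distZ; rewrite weight_delta; apply=> a aA; rewrite dotF2_delta A0.
have En := n1 i (vsplits_uncovered A0) (vsplits_delta eB); subst n.
by apply: (@descent_ord1 R A B true) => //= a /A0; rewrite (ord1 i).
Qed.

Theorem theorem1 (R : realType) (n : nat) (A B : {vspace 'rV['F_2]_n}) (k : nat) :
  css_code A B -> non_splitting A B -> css_distance_gt A B 2 -> (1 <= k)%N ->
  (forall U : 'M[R[i]]_(2 ^ n), one_local U -> clifford k U ->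
     ~ clifford k.-1 U -> ~ logical_identity A B U) ->
  forall m : nat, (k <= m)%N ->
  forall U : 'M[R[i]]_(2 ^ n), one_local U -> clifford m U ->
     ~ clifford k.-1 U -> ~ logical_identity A B U.
Proof.
move=> _ nsAB distAB; case: k => [//|[|k]] _ noU m.
  (* For k = 1 the hypothesis is contradictory: level 0 is empty, and the identity is a Pauli and a
     logical identity. *)
  case: (noU 1%:M) => //.
  - by exists (fun _ => 1%:M); split; [move=> i; exact: unitary1|rewrite tensor1].
  - have := pauli_group_tensor R 0 (fun _ : 'I_n => false) (fun _ => false).
    by rewrite expr0 scale1r [tensor _]tensor1.
  - by move=> psi _; rewrite mul1mx.
(* The hypothesis climbs by [descent] to every exact level above k. *)
have noUd d : forall U : 'M[R[i]]_(2 ^ n), one_local U -> clifford (d + k).+2 U ->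
    ~ clifford (d + k).+1 U -> ~ logical_identity A B U.
  by elim: d => [//|d IHd]; apply: descent.
move=> /subnK <-; rewrite !addnS; move: (m - k.+2)%N => d U U1 + UnC.
(* Walking down from level m, [U] either lies in the next lower level too or is refuted by
   [noUd]. *)
elim: d => [|d IHd] UC; first exact: noU.
have [/IHd//|] := classic (clifford (d + k).+2 U).
exact: noUd UC.
Qed.
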